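(* The quaternary quartic $$Q = X_4^4+X_1^2X_2^2+X_1^2X_3^2+X_2^2X_3^2-4X_1X_2X_3X_4$$ is stubborn.
   Context: A real form is nonnegative if it takes only nonnegative values on $\mathbb{R}^n$. A form of degree $d$ is a sum of squares if it equals $H_1^2+\dots+H_r^2$ for some real forms $H_i$ of degree $d/2$. A nonnegative form $P$ is stubborn if $P^k$ is not a sum of squares for any odd $k\ge 1$. *)

(* Defs.v *)
From mathcomp Require Import all_boot all_order all_algebra.
From mathcomp Require Import reals.
From mathcomp Require Import mpoly.

Set Implicit Arguments.
Unset Strict Implicit.
Unset Printing Implicit Defensive.

Import GRing.Theory Num.Theory.
Local Open Scope ring_scope.

(* The degree is an explicit parameter since the zero form has every degree.  *)
Definition nonneg_form (R : realType) (n d : nat) (P : {mpoly R[n]}) : Prop :=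
  P \is d.-homog /\ forall x : 'I_n -> R, 0 <= P.@[x].

Definition is_sos (R : realType) (n d : nat) (P : {mpoly R[n]}) : Prop :=
  exists2 e : nat, d = e.*2 &
  exists (r : nat) (H : 'I_r -> {mpoly R[n]}),
    (forall i, H i \is e.-homog) /\ P = \sum_(i < r) H i ^+ 2.

(* P ^+ k is a form of degree k * d; odd k entails k >= 1.                    *)
Definition stubborn (R : realType) (n d : nat) (P : {mpoly R[n]}) : Prop :=
  nonneg_form d P /\
  forall k : nat, odd k -> ~ is_sos (k * d) (P ^+ k).

(* The variables X_1, ..., X_4 are 'X_0, ..., 'X_3 in the library's           *)
(* numbering of 'I_4.                                                         *)
Definition Q (R : realType) : {mpoly R[4]} :=
  let X1 : {mpoly R[4]} := 'X_(inord 0) in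
  let X2 : {mpoly R[4]} := 'X_(inord 1) in
  let X3 : {mpoly R[4]} := 'X_(inord 2) in
  let X4 : {mpoly R[4]} := 'X_(inord 3) in
  X4 ^+ 4 + X1 ^+ 2 * X2 ^+ 2 + X1 ^+ 2 * X3 ^+ 2 + X2 ^+ 2 * X3 ^+ 2
    - 4%:R * X1 * X2 * X3 * X4.

(* Main.v *)
Require Import Defs.
From mathcomp Require Import all_boot all_order all_algebra.
From mathcomp Require Import zify ring lra.
From mathcomp Require Import reals.
From mathcomp Require Import mpoly.

Set Implicit Arguments.
Unset Strict Implicit.
Unset Printing Implicit Defensive.

Import Order.TTheory GRing.Theory Num.Theory.
Local Open Scope ring_scope.

(** Nonnegativity: among X_1, X_2, X_3 two have a nonnegative product, say
    X_1 X_2 >= 0, and then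
      Q = (X_4^2 - X_1 X_2)^2 + X_3^2 (X_1 - X_2)^2 + 2 X_1 X_2 (X_4 - X_3)^2
    is visibly nonnegative ([Q_ge0]).

    Odd powers: suppose that Q^k is the sum of the H_i^2. On a line or curve
    where Q is a constant times the square of a polynomial all of whose roots
    are real, each H_i must be a constant times the k-th power of that
    polynomial: the real roots of a sum of squares are shared by the summands,
    and so is the bound on the degree ([sum_sqr_XsubC_exp]). This applies to the
    two lines
      Q(1, 1, t, 1) = 2 (t - 1)^2   and   Q(1, 1, t, -1) = 2 (t + 1)^2,
    on which H_i is therefore c_i (t - 1)^k and c'_i (t + 1)^k ([line_mmap]).
    The two lines are linked in two ways.
    - At t = 0: H_i takes the same value at (1, 1, 0, 1) and (1, 1, 0, -1).
      Both points lie on the curve (s^2, 1, 0, s), on which Q = 2 s^4, so that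
      H_i is a multiple of s^(2k), an even function of s ([const_face]).
    - At t = infinity: the coefficient of t^k in H_i(1, 1, t, u) does not depend
      on u, because Q(1, 1, t, u) is 2 t^2 plus terms of lower degree in t, so
      that the squares of these coefficients add up to the constant 2^k
      ([const_top]).
    The first link says that (-1)^k c_i = c'_i, the second that c_i = c'_i. For
    odd k this forces c_i = 0 for all i, hence Q(1, 1, 0, 1) = 0, whereas this
    value is 2. *)

(** * Sums of squares of univariate polynomials *)

(** This is the property of the coefficients that prevents leading terms of
    squares from cancelling. It passes from [A] to [{poly A}], so that what
    follows also applies to polynomials whose coefficients are polynomials. *)
Definition formally_real (A : nzRingType) : Prop :=
  forall (r : nat) (a : 'I_r -> A),
    \sum_(i < r) a i ^+ 2 = 0 -> forall i, a i = 0.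

Lemma formally_real_realDomain (R : realDomainType) : formally_real R.
Proof.
move=> r a sum0 i; apply/eqP; rewrite -sqrf_eq0.
have /(_ (fun i _ => sqr_ge0 (a i))) h := @psumr_eq0P _ _ xpredT (fun i => a i ^+ 2).
by rewrite h.
Qed.

Lemma coef_sum_sqr (A : comNzRingType) (r m : nat) (h : 'I_r -> {poly A}) :
    (forall i, (size (h i) <= m.+1)%N) ->
  (\sum_(i < r) h i ^+ 2)`_(m.*2) = \sum_(i < r) (h i)`_m ^+ 2.
Proof.
move=> sz_h; rewrite coef_sum; apply: eq_bigr => i _.
have lt_m : (m < m.*2.+1)%N by lia.
have dbl_m : (m.*2 - m)%N = m by lia.
rewrite expr2 coefM (bigD1 (Ordinal lt_m)) //= dbl_m big1 ?addr0 // => j.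
rewrite -val_eqE /= => ne_jm; have := sz_h i.
have [lt_jm|le_mj] := ltnP j m => sz_hi.
- by rewrite [X in _ * X]nth_default ?mulr0 //; apply: (leq_trans sz_hi); lia.
- by rewrite nth_default ?mul0r //; apply: (leq_trans sz_hi); lia.
Qed.

(** Over a formally real ring the top coefficients of the squares cannot cancel,
    so the summands have at most half the degree of the sum. *)
Lemma size_sum_sqr (A : comNzRingType) (r m : nat) (h : 'I_r -> {poly A}) :
    formally_real A -> (size (\sum_(i < r) h i ^+ 2)%R <= m.*2.+1)%N ->
  forall i, (size (h i) <= m.+1)%N.
Proof.
move=> realA sz_sum.
(* A common bound n + m + 1 on the sizes can be lowered as long as n > 0. *)
have descend n : (forall i, (size (h i) <= n + m.+1)%N) ->
    forall i, (size (h i) <= m.+1)%N.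
  elim: n => // n IHn sz_h; apply: IHn => i.
  have sz_h' j : (size (h j) <= (n + m.+1).+1)%N by rewrite -addSn.
  have coef0 : (h i)`_(n + m.+1) = 0.
    apply: (realA _ (fun j => (h j)`_(n + m.+1))).
    rewrite -coef_sum_sqr // nth_default // (leq_trans sz_sum) //.
    lia.
  apply/leq_sizeP => j; rewrite leq_eqVlt => /predU1P [<- //|lt_j].
  by rewrite nth_default // (leq_trans (sz_h' i)).
(* The sum of the sizes is a common bound to start from. *)
apply: (descend (\sum_j size (h j))%N) => i.
by rewrite (bigD1 i) //= -addnA leq_addr.
Qed.

Lemma formally_real_poly (A : comNzRingType) :
  formally_real A -> formally_real {poly A}.
Proof.
move=> realA r h sum0 i.
have sz_h : forall j, (size (h j) <= 1)%N.
  by apply: (@size_sum_sqr _ _ 0) => //; rewrite sum0 size_poly0.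
have /realA/(_ i) coef0 : \sum_(j < r) (h j)`_0 ^+ 2 = 0.
  by rewrite -coef_sum_sqr // sum0 coef0.
by rewrite [h i]size1_polyC // coef0.
Qed.

(** A root of a sum of squares is a root of every summand. Dividing all of them by
    [('X - a)] until the sum is constant leaves constants, by the degree
    bound. The constant is the leading coefficient. *)
Lemma sum_sqr_XsubC_exp (F : realFieldType) (r m : nat) (C a : F)
    (h : 'I_r -> {poly F}) :
    \sum_(i < r) h i ^+ 2 = C *: ('X - a%:P) ^+ m.*2 ->
  forall i, h i = (h i)`_m *: ('X - a%:P) ^+ m.
Proof.
move=> sum_h i; have [c ->] : exists c, h i = c *: ('X - a%:P) ^+ m.
  elim: m h sum_h => [|m IHm] h sum_h.
    exists (h i)`_0; rewrite expr0 alg_polyC; apply: size1_polyC.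
    apply: (@size_sum_sqr _ _ 0 h (@formally_real_realDomain F)).
    by rewrite sum_h alg_polyC size_polyC leq_b1.
  have root_h j : h j = h j %/ ('X - a%:P) * ('X - a%:P).
    rewrite divpK // dvdp_XsubCl; apply/eqP.
    apply: (@formally_real_realDomain F r (fun j => (h j).[a])).
    transitivity (\sum_(j < r) h j ^+ 2).[a].
      by rewrite horner_sum; apply: eq_bigr => l _; rewrite horner_exp.
    by rewrite sum_h hornerZ horner_exp hornerXsubC subrr expr0n mulr0.
  have [|c hc] := IHm (fun j => h j %/ ('X - a%:P)).
    have nz : ('X - a%:P) ^+ 2 != 0 :> {poly F} by rewrite expf_neq0 // polyXsubC_eq0.
    apply: (mulIf nz); rewrite mulr_suml -scalerAl -exprD addn2 -doubleS -sum_h.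
    by apply: eq_bigr => j _; rewrite -exprMn -root_h.
  by exists c; rewrite root_h hc -scalerAl -exprSr.
congr (_ *: _); rewrite coefZ.
have /monicP := monic_exp m (monicXsubC a).
by rewrite lead_coefE size_exp_XsubC /= => ->; rewrite mulr1.
Qed.

(** * Evaluation of forms in commutative rings *)

Definition point (S : Type) (x1 x2 x3 x4 : S) : 'I_4 -> S :=
  tnth [tuple x1; x2; x3; x4].

Lemma mmap_Q (R : realType) (S : comNzRingType) (f : {rmorphism R -> S})
    (x1 x2 x3 x4 : S) :
  mmap f (point x1 x2 x3 x4) (Q R) =
    x4 ^+ 4 + x1 ^+ 2 * x2 ^+ 2 + x1 ^+ 2 * x3 ^+ 2 + x2 ^+ 2 * x3 ^+ 2
      - 4%:R * x1 * x2 * x3 * x4.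
Proof.
rewrite /Q !(rmorph_nat, rmorphB, rmorphD, rmorphM, rmorphXn) /= !mmapX !mmap1U.
by rewrite /point !(tnth_nth x1) !inordK.
Qed.

Lemma rmorph_mmap (R S T : comNzRingType) (f : {rmorphism R -> S})
    (g : {rmorphism S -> T}) (n : nat) (h : 'I_n -> S) (p : {mpoly R[n]}) :
  g (mmap f h p) = mmap (g \o f) (g \o h) p.
Proof.
rewrite /mmap rmorph_sum; apply: eq_bigr => m _.
rewrite rmorphM rmorph_prod; congr (_ * _).
by apply: eq_bigr => i _; rewrite rmorphXn.
Qed.

Lemma horner_mmap (R : comNzRingType) (n : nat) (h : 'I_n -> {poly R})
    (p : {mpoly R[n]}) (a : R) :
  (mmap polyC h p).[a] = p.@[fun j => (h j).[a]].
Proof.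
rewrite -/(horner_eval a _) rmorph_mmap /meval /mmap.
by apply: eq_bigr => m _; rewrite /= /horner_eval hornerC.
Qed.

(** * The quartic is a nonnegative form *)

Lemma homog_Q (R : realType) : Q R \is 4.-homog.
Proof.
have hX i : ('X_i : {mpoly R[4]}) \is 1.-homog by rewrite dhomogX /= mdeg1.
have hX2 i : ('X_i ^+ 2: {mpoly R[4]}) \is 2.-homog by exact: (@dhomogMn _ _ _ 1).
rewrite /Q rpredB ?rpredD //; try exact: (dhomogM (hX2 _) (hX2 _)).
  exact: (@dhomogMn _ _ _ 1 _ 4).
rewrite -!mulrA mulr_natl rpredMn //.
exact: (dhomogM (hX _) (dhomogM (hX _) (dhomogM (hX _) (hX _)))).
Qed.

Lemma Q_ge0 (R : realType) (x : 'I_4 -> R) : 0 <= (Q R).@[x].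
Proof.
have -> : (Q R).@[x] = mmap idfun
    (point (x (inord 0)) (x (inord 1)) (x (inord 2)) (x (inord 3))) (Q R).
  apply: meval_eq => i; rewrite /point; case: i => [[|[|[|[|i]]]] //= lt_i];
  by rewrite (tnth_nth 0) /=; congr x; apply: val_inj; rewrite /= inordK.
rewrite mmap_Q.
move: (x (inord 0)) (x (inord 1)) (x (inord 2)) (x (inord 3)) => x1 x2 x3 x4.
have sos_pair (a b : R) : 0 <= a * b -> forall c, 0 <= x4 ^+ 4 + a ^+ 2 * b ^+ 2
    + a ^+ 2 * c ^+ 2 + b ^+ 2 * c ^+ 2 - 4%:R * a * b * c * x4.
  move=> ab_ge0 c.
  have -> : x4 ^+ 4 + a ^+ 2 * b ^+ 2 + a ^+ 2 * c ^+ 2 + b ^+ 2 * c ^+ 2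
      - 4%:R * a * b * c * x4 = (x4 ^+ 2 - a * b) ^+ 2 + (c * (a - b)) ^+ 2
      + 2%:R * (a * b) * (x4 - c) ^+ 2 by ring.
  by rewrite addr_ge0 ?addr_ge0 ?sqr_ge0 // mulr_ge0 ?sqr_ge0 // mulr_ge0.
have [/sos_pair/(_ x3) //|x12] := lerP 0 (x1 * x2).
have [/sos_pair/(_ x2) h|x13] := lerP 0 (x1 * x3).
  by apply: le_trans h _; rewrite le_eqVlt; apply/orP; left; apply/eqP; ring.
have /sos_pair/(_ x1) h : 0 <= x2 * x3.
  have : 0 < x1 ^+ 2 * (x2 * x3).
    by rewrite (_ : _ * _ = x1 * x2 * (x1 * x3)) ?nmulr_rgt0 //; ring.
  by apply: contraTT; rewrite -ltNge -leNgt => /ltW; apply/mulr_ge0_le0/sqr_ge0.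
by apply: le_trans h _; rewrite le_eqVlt; apply/orP; left; apply/eqP; ring.
Qed.

(** * Odd powers of the quartic *)

Lemma sum_mmap_sqr (R : realType) (k r : nat) (H : 'I_r -> {mpoly R[4]})
    (S : comNzRingType) (f : {rmorphism R -> S}) (x1 x2 x3 x4 : S) :
    Q R ^+ k = \sum_(i < r) H i ^+ 2 ->
  \sum_(i < r) mmap f (point x1 x2 x3 x4) (H i) ^+ 2 =
    (x4 ^+ 4 + x1 ^+ 2 * x2 ^+ 2 + x1 ^+ 2 * x3 ^+ 2 + x2 ^+ 2 * x3 ^+ 2
      - 4%:R * x1 * x2 * x3 * x4) ^+ k.
Proof.
move=> sum_H; rewrite -(mmap_Q f) -rmorphXn sum_H rmorph_sum.
by apply: eq_bigr => i _; rewrite rmorphXn.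
Qed.

Definition line (R : realType) (e : R) : 'I_4 -> {poly R} := point 1 1 'X e%:P.

(** On the line (1, 1, t, e) with [e = 1] or [e = -1], Q equals 2 (t - e)^2. *)
Lemma line_mmap (R : realType) (k r : nat) (H : 'I_r -> {mpoly R[4]}) (e : R) :
    Q R ^+ k = \sum_(i < r) H i ^+ 2 -> e ^+ 2 = 1 -> forall i,
  mmap polyC (line e) (H i) = (mmap polyC (line e) (H i))`_k *: ('X - e%:P) ^+ k.
Proof.
move=> sum_H e2; apply: (@sum_sqr_XsubC_exp _ _ _ (2 ^+ k)).
rewrite (sum_mmap_sqr _ _ _ _ _ sum_H) -mul2n exprM -exprZn -mul_polyC; congr (_ ^+ k).
have E : (e%:P) ^+ 2 = 1 :> {poly R} by rewrite -rmorphXn e2.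
rewrite (_ : 4 = 2 * 2)%N // exprM E !expr1n !mul1r !mulr1.
rewrite sqrrB E rmorph_nat.
ring.
Qed.

(** Q is constant along the orbits (l, 1/l, 0, u) of a torus acting on the face
    X_3 = 0, hence so are the [H i], being bounded there; the orbits of
    (1, 1, 0, 1) and (1, 1, 0, -1) are exchanged by a change of sign of all the
    variables. Clearing the denominators turns this into the statement that
    [H i] restricts to a monomial of even degree on the curve (s^2, 1, 0, s). *)
Lemma const_face (R : realType) (k r : nat) (H : 'I_r -> {mpoly R[4]}) (i : 'I_r) :
    Q R ^+ k = \sum_(i < r) H i ^+ 2 ->
  (H i).@[point 1 1 0 1] = (H i).@[point 1 1 0 (- 1)].
Proof.
move=> sum_H; pose h j := mmap polyC (point ('X ^+ 2) 1 0 'X) (H j).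
have h_mono : h i = (h i)`_k.*2 *: ('X - 0%:P) ^+ k.*2.
  apply: (@sum_sqr_XsubC_exp _ _ _ (2 ^+ k)).
  rewrite (sum_mmap_sqr _ _ _ _ _ sum_H) polyC0 subr0 -2!mul2n mulnA exprM -exprZn.
  congr (_ ^+ k); rewrite -mul_polyC rmorph_nat; ring.
have h_eval a : a ^+ 2 = 1 -> (h i).[a] = (H i).@[point 1 1 0 a].
  move=> a2; rewrite horner_mmap; apply: meval_eq => j; rewrite /point.
  by case: j => [[|[|[|[|j]]]] //= lt_j]; rewrite !(tnth_nth 0) /= !hornerE ?a2.
rewrite -!h_eval ?sqrrN ?expr1n // h_mono !(hornerZ, horner_exp, hornerXsubC).
by rewrite !subr0 -mul2n !(exprM _ 2) sqrrN.
Qed.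

(** The fourth coordinate u becomes the variable of the coefficient ring, so that
    [H i] restricts to a polynomial in t over [{poly R}]. By the degree bound
    over [{poly R}] its degree in t is at most [k], and by the degree bound over
    [R] its coefficient of t^k is constant in u, since the squares of these
    coefficients add up to 2^k. *)
Lemma const_top (R : realType) (k r : nat) (H : 'I_r -> {mpoly R[4]}) (i : 'I_r) :
    Q R ^+ k = \sum_(i < r) H i ^+ 2 ->
  (mmap polyC (line 1) (H i))`_k = (mmap polyC (line (- 1)) (H i))`_k.
Proof.
move=> sum_H.
pose h j : {poly {poly R}} := mmap (polyC \o polyC) (point 1 1 'X 'X%:P) (H j).
have h_eval e : mmap polyC (line e) (H i) = map_poly (horner_eval e) (h i).
  rewrite rmorph_mmap /mmap; apply: eq_bigr => m _; congr (_ * _).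
    by rewrite /= map_polyC /= /horner_eval hornerC.
  apply: eq_bigr => j _; congr (_ ^+ _); rewrite /line /point /=.
  case: j => [[|[|[|[|j]]]] //= lt_j]; rewrite !(tnth_nth 0) /=.
  - by rewrite rmorph1.
  - by rewrite rmorph1.
  - by rewrite map_polyX.
  - by rewrite map_polyC /= /horner_eval hornerX.
rewrite !h_eval !coef_map /=.
(* p is Q(1, 1, t, u), a polynomial in t with coefficients in R[u]. *)
pose p : {poly {poly R}} := Poly [:: 'X ^+ 4 + 1; - (4%:R * 'X); 2%:R].
have two_nz : 2%:R != 0 :> {poly R} by rewrite -polyC_natr polyC_eq0 pnatr_eq0.
have pE : p = [:: 'X ^+ 4 + 1; - (4%:R * 'X); 2%:R] :> seq _.
  by apply: (@PolyK _ 0).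
have sz_p : size p = 3 by rewrite pE.
have sum_h : \sum_(j < r) h j ^+ 2 = p ^+ k.
  rewrite (sum_mmap_sqr _ _ _ _ _ sum_H); congr (_ ^+ k).
  rewrite /p /= !cons_poly_def mul0r add0r.
  rewrite !(rmorph_nat, rmorphD, rmorphN, rmorphM, rmorphXn, rmorph1) /=.
  ring.
have sz_pk : size (p ^+ k) = k.*2.+1.
  rewrite -(@prednK (size (p ^+ k))) ?size_exp ?sz_p; last first.
    by rewrite size_poly_gt0 expf_neq0 // -size_poly_gt0 sz_p.
  by rewrite mul2n.
have real_R := @formally_real_realDomain R.
have real_Rt := formally_real_poly real_R.
have sz_h : forall j, (size (h j) <= k.+1)%N.
  by apply: (size_sum_sqr real_Rt); rewrite sum_h sz_pk.
have sz_top : (size ((h i)`_k)%R <= 1)%N.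
  apply: (@size_sum_sqr _ _ 0 (fun j => (h j)`_k)) => //.
  rewrite -coef_sum_sqr // sum_h.
  have -> : (p ^+ k)`_k.*2 = lead_coef (p ^+ k) by rewrite lead_coefE sz_pk.
  rewrite lead_coef_exp lead_coefE sz_p pE /=.
  by rewrite -polyC_natr -rmorphXn size_polyC leq_b1.
by rewrite [(h i)`_k]size1_polyC // /horner_eval !hornerC.
Qed.

Theorem theorem39 (R : realType) : stubborn 4 (Q R).
Proof.
split; first by split; [exact: homog_Q | exact: Q_ge0].
move=> k odd_k [e _ [r [H [_ sum_H]]]].
have val_line (c : R) i : (mmap polyC (line c) (H i)).[0] = (H i).@[point 1 1 0 c].
  rewrite horner_mmap; apply: meval_eq => j; rewrite /line /point.
  by case: j => [[|[|[|[|j]]]] //= lt_j]; rewrite !(tnth_nth 0) /= !hornerE.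
(* The two links give c_i * (-1)^k = c_i, and k is odd. *)
have H0 i : (H i).@[point 1 1 0 1] = 0.
  have := const_face i sum_H; rewrite -!val_line.
  rewrite (line_mmap sum_H) ?expr1n // (line_mmap sum_H (e := - 1)) ?sqrrN ?expr1n //.
  rewrite -(const_top _ sum_H) !hornerE opprK expr1n -signr_odd odd_k expr1 mulr1 mulrN1.
  set c := _`_k => h; have : c = 0 by lra.
  by move=> ->; rewrite oppr0.
have := sum_mmap_sqr idfun 1 1 0 1 sum_H.
rewrite big1 => [|i _]; last by rewrite -/(meval _ _) H0 expr0n.
move/esym/eqP; rewrite expf_eq0 => /andP [_].
rewrite !expr1n expr0n /= !mulr0 mul0r !addr0 subr0 mulr1.
by rewrite -(natrD _ 1 1) pnatr_eq0.
Qed.
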